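(* Let $d=p^{\alpha}q^{\beta}$ with $p\neq q$ primes and $\alpha,\beta\geqslant 1$ integers. Then for every positive integer $Q$ and every $i\in\{0,\dots,\#\mathcal F_Q-5\}$ there exists $j\in\{0,\dots,5\}$ such that $(q_{i+j},d)=1$. Consequently $L(d)\leqslant 5$.
   Context: For a positive integer $Q$, $\mathcal F_Q$ is the set of rational numbers $\frac{a}{q}\in(0,1]$ with $(a,q)=1$ and $1\leqslant q\leqslant Q$ (Farey fractions of order $Q$), where $(m,n)$ denotes the gcd. Put $N=\#\mathcal F_Q$, write the elements of $\mathcal F_Q$ in increasing order as $\gamma_1<\gamma_2<\cdots<\gamma_N=1$, and put $\gamma_0=\frac01$; write $\gamma_i=\frac{a_i}{q_i}$ in lowest terms for $0\leqslant i\leqslant N$ (so $q_0=1$). The index set $\{0,\dots,\#\mathcal F_Q-5\}$ is empty if $\#\mathcal F_Q<5$. (The prime $q$ without subscript in the claim is unrelated to the denominators $q_i$.) For a positive integer $d$, $L(d)$ is the smallest nonnegative integer $L$ such that for every $Q$ and every string $\gamma_i<\gamma_{i+1}<\cdots<\gamma_{i+L}$ of $L+1$ consecutive elements of $\mathcal F_Q$, there is $j\in\{0,1,\dots,L\}$ with $(q_{i+j},d)=1$. *)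

(* Defs.v *)
From mathcomp Require Import all_boot all_order all_algebra.
Set Implicit Arguments.
Unset Strict Implicit.
Unset Printing Implicit Defensive.
Import Order.TTheory GRing.Theory Num.Theory.
Local Open Scope ring_scope.

(* Increasing and duplicate-free, by sort_le_sorted and farey_uniq below. *)
Definition farey (Q : nat) : seq rat :=
  sort <=%O [seq (a%:R / b%:R : rat) | b <- iota 1 Q,
                                       a <- [seq a <- iota 1 b | coprime a b]].

(* With gamma_0 = 0/1 prepended, gamma Q i is the i-th fraction for
   0 <= i <= size (farey Q); beyond that it takes a meaningless default value,
   so every use must bound the index. *)
Definition gamma (Q i : nat) : rat := nth 0 (0 :: farey Q) i.

Definition gamma_den (Q i : nat) : nat := `|denq (gamma Q i)|%N.

(* Strings consist of elements of the Farey set itself, hence start at an index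
   i >= 1: gamma_0 = 0 is not in (0, 1]. *)
Definition coprime_in_strings (d L : nat) : Prop :=
  forall Q i : nat, (0 < Q)%N -> (0 < i)%N -> (i + L <= size (farey Q))%N ->
  exists2 j : nat, (j <= L)%N & coprime (gamma_den Q (i + j)) d.

(* is_L d L means "L(d) exists and equals L". *)
Definition is_L (d L : nat) : Prop :=
  coprime_in_strings d L /\
  forall L' : nat, coprime_in_strings d L' -> (L <= L')%N.

Lemma denq_natf (a b : nat) :
  coprime a b -> (0 < b)%N -> denq (a%:R / b%:R) = b.
Proof.
move=> cab b0; have := @coprimeq_den a b cab.
by rewrite -!pmulrn eqz_nat gtn_eqF.
Qed.

Lemma farey_uniq (Q : nat) : uniq (farey Q).
Proof.
rewrite sort_uniq; apply: allpairs_uniq_dep.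
- exact: iota_uniq.
- by move=> b _; rewrite filter_uniq ?iota_uniq.
have H (t : {_ : nat & nat}) :
    t \in [seq existT (fun=> nat) b a | b <- iota 1 Q,
             a <- [seq a <- iota 1 b | coprime a b]] ->
    (0 < tag t)%N && coprime (tagged t) (tag t).
  case/allpairsPdep=> b [a [bQ ab ->]] /=.
  move: bQ ab; rewrite mem_iota mem_filter => /andP[b0 _] /andP[-> _].
  by rewrite b0.
move=> [b a] [b' a'] /H/andP[/= b0 cab] /H/andP[/= b'0 cab'] e.
have eb : b = b' by have := congr1 denq e; rewrite !denq_natf // => -[].
subst b'; congr existT; apply/eqP; rewrite -(eqr_nat rat); apply/eqP.
by apply: (mulIf _ e); rewrite invr_eq0 pnatr_eq0 -lt0n.
Qed.

Lemma mem_farey (Q : nat) (x : rat) :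
  (x \in farey Q) = (0 < x <= 1) && (denq x <= Q%:Z).
Proof.
rewrite mem_sort; apply/allpairsPdep/idP => [[b [a []]]|].
  rewrite mem_iota mem_filter mem_iota => /andP[b0 bQ] /and3P[cab a0 ab] ->.
  rewrite add1n ltnS in bQ; rewrite add1n ltnS in ab.
  rewrite denq_natf // divr_gt0 ?ltr0n //=.
  by rewrite ler_pdivrMr ?ltr0n // mul1r ler_nat ab.
case/andP=> /andP[x0 x1] dQ.
have n0 : 0 < numq x by rewrite numq_gt0.
have xE : x = `|numq x|%:R / `|denq x|%:R.
  by rewrite !pmulrn !gez0_abs ?divq_num_den ?ltW.
have d0 : (0 < `|denq x|)%N by rewrite absz_gt0 denq_eq0.
exists `|denq x|%N, `|numq x|%N; split=> //.
  by rewrite mem_iota d0 add1n ltnS -lez_nat gez0_abs.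
rewrite mem_filter mem_iota coprime_num_den absz_gt0 (gt_eqF n0) add1n ltnS /=.
by rewrite xE ler_pdivrMr ?ltr0n // mul1r ler_nat in x1.
Qed.

(* Main.v *)
(* Suppose six consecutive denominators q0, ..., q5 all meet {p, q}. Since
   neighbours are coprime, p divides say q0, q2, q4 and q divides q1, q3, q5, so
   in q_(j) + q_(j+2) = k_j q_(j+1) the indices k0, k2 are multiples of p and
   k1, k3 multiples of q. Thus all four are at least 2, and k1 or k2 is at least
   3. From q_j <= Q < q_j + q_(j+1) an inner index that is at least 3 equals 3,
   and the index two steps away, across the other inner one, equals 2; both are
   multiples of the same prime, a contradiction. *)
Require Import Defs.
From mathcomp Require Import all_boot all_order all_algebra.
From mathcomp Require Import zify ring.
From Stdlib Require Import Classical.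
Set Implicit Arguments.
Unset Strict Implicit.
Unset Printing Implicit Defensive.
Import Order.TTheory GRing.Theory Num.Theory.

Local Open Scope ring_scope.

(** * Gaps between fractions, over the integers *)

Lemma ltq_num_den (x y : rat) :
  (x < y) = (numq x * denq y < numq y * denq x).
Proof. exact: lt_ratE. Qed.

(** The [v] that solve the equation fill a residue class modulo [b], and the window has length
    [b]. *)
Lemma bezout_in_window (a b Q : int) : 0 < b -> coprimez a b ->
  exists u v : int, [/\ u * b - a * v = 1, Q - b < v & v <= Q].
Proof.
move=> b0 /coprimezP[[s t] /= st].
pose k := ((Q + s) %/ b)%Z.
have b0' : b != 0 by rewrite gt_eqF.
have e : Q + s = k * b + ((Q + s) %% b)%Z := divz_eq _ _.
have m0 := modz_ge0 (Q + s) b0'; have m1 := ltz_pmod (Q + s) b0.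
exists (t + k * a), (k * b - s); split; last 2 first.
- lia.
- lia.
by rewrite -st; ring.
Qed.

(** The Bezout fraction [u / v] with [Q - b < v <= Q] lies to the right of [a / b], hence not to the
    left of [c / d]; the size of [d] then makes it equal to [c / d]. *)
Lemma empty_farey_interval (a b c d Q : int) :
  0 < b <= Q -> 0 < d <= Q -> coprimez a b -> coprimez c d -> a * d < c * b ->
  (forall u v : int, 0 < v <= Q -> a * v < u * b -> ~ u * d < c * v) ->
  c * b - a * d = 1 /\ Q < b + d.
Proof.
move=> /andP[b0 bQ] /andP[d0 dQ] cab ccd ltad nobetw; split; last first.
  case: (ltP Q (b + d)) => // le; exfalso.
  (* The mediant lies strictly between the two fractions. *)
  apply: (nobetw (a + c) (b + d)).
  - by rewrite le; lia.
  - by rewrite mulrDr mulrDl mulrC; lia.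
  - by rewrite mulrDr mulrDl; lia.
have [u [v [uv vl vQ]]] := bezout_in_window Q b0 cab.
have v0 : 0 < v by lia.
have ge : c * v <= u * d.
  rewrite leNgt; apply/negP; apply: nobetw; first by rewrite v0.
  by lia.
set D := c * b - a * d.
(* d = d (u b - a v) splits as b (u d - c v) + v D, two nonnegative terms. *)
have dE : d = b * (u * d - c * v) + v * D by rewrite -[LHS]mulr1 -uv /D; ring.
have D1 : 1 <= D by rewrite /D; lia.
(* By [dE], a positive [u * d - c * v] would give [d >= b + v > Q]. *)
have eq : u * d = c * v.
  apply/eqP; rewrite -subr_eq0; apply/eqP; nia.
(* Now [d = v * D] and [c = u * D], so coprimality forces [D = 1]. *)
have dD : (D %| d)%Z by apply/dvdzP; exists v; rewrite {1}dE eq subrr mulr0 add0r.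
have cD : (D %| c)%Z.
  apply/dvdzP; exists u; rewrite -[LHS]mulr1 -uv /D.
  by rewrite !mulrBr [u * (a * d)]mulrCA eq; ring.
have : (D %| gcdz c d)%Z by rewrite dvdz_gcd cD.
rewrite (eqP ccd) dvdz1; lia.
Qed.

(** * Neighbours in the Farey sequence *)

Lemma farey_lt_sorted (Q : nat) : sorted <%O (farey Q).
Proof. by rewrite sort_lt_sorted -(sort_uniq <=%O) farey_uniq. Qed.

Lemma gamma_farey (Q i : nat) :
  (0 < i <= size (farey Q))%N -> gamma Q i \in farey Q.
Proof. by case: i => // i /= iN; apply: mem_nth. Qed.

Lemma denq_gamma (Q i : nat) : denq (gamma Q i) = (gamma_den Q i)%:Z.
Proof. by rewrite /gamma_den gez0_abs // ltW. Qed.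

Lemma gamma_den_le (Q i : nat) :
  (0 < i <= size (farey Q))%N -> (gamma_den Q i <= Q)%N.
Proof.
move/gamma_farey; rewrite mem_farey denq_gamma => /andP[_].
by rewrite lez_nat.
Qed.

Lemma gamma_den_gt0 (Q i : nat) : (0 < gamma_den Q i)%N.
Proof. by rewrite absz_gt0 denq_eq0. Qed.

Lemma gamma_lt (Q i : nat) :
  (0 < i < size (farey Q))%N -> gamma Q i < gamma Q i.+1.
Proof.
case: i => // i /= iN; rewrite /gamma /=.
by rewrite (lt_sorted_ltn_nth 0 (farey_lt_sorted Q)) // inE ltnW.
Qed.

Lemma gamma_gap (Q i : nat) (z : rat) : (0 < i < size (farey Q))%N ->
  gamma Q i < z -> z < gamma Q i.+1 -> Q%:Z < denq z.
Proof.
case: i => // i /= iN ltiz ltzi; rewrite ltNge; apply/negP => zQ.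
have := @gamma_farey Q i.+1; have := @gamma_farey Q i.+2.
rewrite /= iN ltnW // => /(_ isT) + /(_ isT); rewrite !mem_farey.
move=> /andP[/andP[_ y1] _] /andP[/andP[x0 _] _].
have : z \in farey Q.
  by rewrite mem_farey zQ (lt_trans x0 ltiz) (le_trans (ltW ltzi) y1).
case/(nthP 0) => k kN zE; move: ltiz ltzi; rewrite -zE /gamma /=.
rewrite !(lt_sorted_ltn_nth 0 (farey_lt_sorted Q)) ?inE //; last exact: ltnW.
by rewrite ltnS => ik /(leq_trans ik); rewrite ltnn.
Qed.

Lemma gamma_neighbours (Q i : nat) : (0 < i < size (farey Q))%N ->
  let x := gamma Q i in let y := gamma Q i.+1 in
  numq y * denq x - numq x * denq y = 1 /\ Q%:Z < denq x + denq y.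
Proof.
move=> iN x y; have /andP[i0 iN'] := iN.
apply: empty_farey_interval.
- by rewrite denq_gt0 denq_gamma lez_nat gamma_den_le ?i0 // ltnW.
- by rewrite denq_gt0 denq_gamma lez_nat gamma_den_le.
- by rewrite coprimezE coprime_num_den.
- by rewrite coprimezE coprime_num_den.
- by rewrite -ltq_num_den gamma_lt.
move=> u v /andP[v0 vQ] l1 l2.
(* The pair [u], [v] need not be reduced: it is [k] times the reduced pair of [z], whose denominator
   is then at most [Q] too. *)
move: l1 l2 v0 vQ; case: (divqP u v) => [_|k z _]; first by rewrite ltxx.
move=> l1 l2 kz0 vQ; have k0 : 0 < k by rewrite pmulr_lgt0 // in kz0.
rewrite mulrCA -mulrA ltr_pM2l // -ltq_num_den in l1.
rewrite -mulrA [X in _ < X]mulrCA ltr_pM2l // -ltq_num_den in l2.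
have := gamma_gap iN l1 l2; rewrite ltNge => /negP; apply; apply: le_trans vQ.
by rewrite ler_pMl ?denq_gt0 // -gtz0_ge1.
Qed.

Lemma gamma_den_add_gt (Q i : nat) : (0 < i < size (farey Q))%N ->
  (Q < gamma_den Q i + gamma_den Q i.+1)%N.
Proof. by case/gamma_neighbours => _; rewrite !denq_gamma; lia. Qed.

Lemma coprime_gamma_den (Q i : nat) : (0 < i < size (farey Q))%N ->
  coprime (gamma_den Q i) (gamma_den Q i.+1).
Proof.
case/gamma_neighbours; rewrite !denq_gamma => det _.
rewrite -[gamma_den Q i]/(`|(gamma_den Q i)%:Z|%N).
rewrite -[gamma_den Q i.+1]/(`|(gamma_den Q i.+1)%:Z|%N) -coprimezE.
apply/coprimezP; exists (numq (gamma Q i.+1), - numq (gamma Q i)) => /=.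
by rewrite mulNr.
Qed.

(** Subtracting the two determinant identities shows that the middle denominator divides the sum
    times the middle numerator, to which it is coprime. *)
Lemma gamma_den_dvd_add (Q i : nat) : (0 < i)%N -> (i.+1 < size (farey Q))%N ->
  (gamma_den Q i.+1 %| gamma_den Q i + gamma_den Q i.+2)%N.
Proof.
move=> i0 iN.
have [] := @gamma_neighbours Q i; first by rewrite i0 ltnW.
have [] := @gamma_neighbours Q i.+1; first exact: iN.
rewrite !denq_gamma => det2 _ det1 _.
set x := gamma Q i in det1; set y := gamma Q i.+1 in det1 det2.
set z := gamma Q i.+2 in det2.
have cop : coprimez (gamma_den Q i.+1) (numq y).
  by rewrite -denq_gamma coprimezE coprime_sym coprime_num_den.
suff: ((gamma_den Q i.+1)%:Z %| (gamma_den Q i + gamma_den Q i.+2)%N%:Z)%Z by [].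
rewrite -(Gauss_dvdzr _ cop); apply/dvdzP; exists (numq x + numq z).
by rewrite PoszD; lia.
Qed.

(* Size and divisibility of the indices *)
Local Close Scope ring_scope.

(* The bounds force Q/3 < q2 <= Q/2 and Q/2 < q1, q3; then k3 > 2 would give
   q5 >= 5 q3 - 3 q2 > 5 Q - 8 q2, so that q5 <= Q fails. *)
Lemma index_ge3_forces_next (Q q0 q1 q2 q3 q4 q5 k0 k1 k2 k3 : nat) :
  q0 <= Q -> q1 <= Q -> q4 <= Q -> q5 <= Q -> Q < q1 + q2 -> Q < q2 + q3 ->
  q0 + q2 = k0 * q1 -> q1 + q3 = k1 * q2 ->
  q2 + q4 = k2 * q3 -> q3 + q5 = k3 * q4 ->
  1 < k0 -> 2 < k1 -> 1 < k2 -> 1 < k3 -> k1 = 3 /\ k3 = 2.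
Proof.
move=> h0 h1 h4 h5 h12 h23 e0 e1 e2 e3 K0 K1 K2 K3.
have l0 : 2 * q1 <= q0 + q2 by rewrite e0 leq_mul2r K0 orbT.
have l1 : 3 * q2 <= q1 + q3 by rewrite e1 leq_mul2r K1 orbT.
have l2 : 2 * q3 <= q2 + q4 by rewrite e2 leq_mul2r K2 orbT.
split.
  apply/eqP; rewrite eqn_leq K1 andbT leqNgt; apply/negP => k1_gt3.
  have : 4 * q2 <= q1 + q3 by rewrite e1 leq_mul2r k1_gt3 orbT.
  lia.
apply/eqP; rewrite eqn_leq K3 andbT leqNgt; apply/negP => k3_gt2.
have : 3 * q4 <= q3 + q5 by rewrite e3 leq_mul2r k3_gt2 orbT.
lia.
Qed.

(** As [p] divides [a], it is coprime to [b], so it passes from [k * b] to [k]; and [k] is nonzero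
    because [a] is positive. *)
Lemma prime_dvd_quotient (p a b c k : nat) :
  prime p -> 0 < a -> coprime a b -> p %| a -> p %| c -> a + c = k * b ->
  1 < k /\ p %| k.
Proof.
move=> pp a0 cab pa pc e.
have pk : p %| k.
  rewrite -(@Gauss_dvdl _ _ b) -?e ?dvdn_add //.
  exact: coprime_dvdl pa cab.
split=> //; apply: leq_trans (prime_gt1 pp) (dvdn_leq _ pk).
by case: k e {pk} => //; rewrite mul0n; lia.
Qed.

Lemma no_alternating_divisors (p q Q : nat) (f : nat -> nat) :
  prime p -> prime q -> p != q ->
  (forall j, j <= 5 -> 0 < f j <= Q) ->
  (forall j, j <= 4 -> Q < f j + f j.+1 /\ coprime (f j) (f j.+1)) ->
  (forall j, j <= 3 -> f j.+1 %| f j + f j.+2) ->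
  p %| f 0 -> p %| f 2 -> p %| f 4 -> q %| f 1 -> q %| f 3 -> q %| f 5 ->
  False.
Proof.
move=> pp pq npq bd adj dv p0 p2 p4 q1 q3 q5.
have /dvdnP[k0 e0] := dv 0 isT; have /dvdnP[k1 e1] := dv 1 isT.
have /dvdnP[k2 e2] := dv 2 isT; have /dvdnP[k3 e3] := dv 3 isT.
have [/andP[f0 b0] /andP[f1 b1]] := (bd 0 isT, bd 1 isT).
have [/andP[f2 b2] /andP[f3 b3]] := (bd 2 isT, bd 3 isT).
have [/andP[f4 b4] /andP[f5 b5]] := (bd 4 isT, bd 5 isT).
have [[a0 c0] [a1 c1]] := (adj 0 isT, adj 1 isT).
have [[a2 c2] [a3 c3]] := (adj 2 isT, adj 3 isT).
have [a4 c4] := adj 4 isT.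
have [g0 d0] := prime_dvd_quotient pp f0 c0 p0 p2 e0.
have [g1 d1] := prime_dvd_quotient pq f1 c1 q1 q3 e1.
have [g2 d2] := prime_dvd_quotient pp f2 c2 p2 p4 e2.
have [g3 d3] := prime_dvd_quotient pq f3 c3 q3 q5 e3.
case: (ltnP 2 k1) => [k1_gt2|k1_le2].
  have [k1E k3E] :=
    index_ge3_forces_next b0 b1 b4 b5 a1 a2 e0 e1 e2 e3 g0 k1_gt2 g2 g3.
  have : q %| k1 - k3 by rewrite dvdn_sub.
  by rewrite k1E k3E dvdn1 => /eqP q1E; rewrite q1E in pq.
have k1E : k1 = 2 by lia.
(* With [q = 2] the prime [p] is odd, so its multiple [k2 > 1] cannot be 2. *)
have qE : q = 2 by apply/eqP; rewrite k1E dvdn_prime2 // in d1.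
have k2_gt2 : 2 < k2.
  rewrite ltn_neqAle g2 andbT; apply: contraNneq npq => k2E.
  by rewrite -k2E dvdn_prime2 // in d2; rewrite qE.
(* Reading the six denominators backwards puts [k2] in the place of [k1]. *)
have [k2E k0E] : k2 = 3 /\ k0 = 2.
  apply: (@index_ge3_forces_next Q (f 5) (f 4) (f 3) (f 2) (f 1) (f 0)
    k3 k2 k1 k0 b5 b4 b1 b0); by rewrite // addnC.
have : p %| k2 - k0 by rewrite dvdn_sub.
by rewrite k2E k0E dvdn1 => /eqP p1E; rewrite p1E in pp.
Qed.

(** * From six denominators to the bound on [L(d)] *)

Lemma coprime_pfactors (p q alpha beta m : nat) : prime p -> prime q ->
  ~~ coprime m (p ^ alpha * q ^ beta) -> (p %| m) || (q %| m).
Proof.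
move=> pp pq; apply: contraR; rewrite negb_or => /andP[pm qm].
by rewrite coprimeMr !coprimeXr // coprime_sym prime_coprime.
Qed.

Lemma dvd_alternate (p q a b : nat) : prime p -> coprime a b ->
  p %| a -> (p %| b) || (q %| b) -> q %| b.
Proof.
move=> pp cab pa /orP[pb|//].
by have := prime_gt1 pp; have := dvdn_gcd p a b; rewrite pa pb (eqP cab) dvdn1;
  case: eqP => // ->.
Qed.

Lemma coprime_among_six_denominators (p q alpha beta Q i : nat) :
  prime p -> prime q -> p != q -> i + 5 <= size (farey Q) ->
  exists2 j : nat, j <= 5 &
    coprime (gamma_den Q (i + j)) (p ^ alpha * q ^ beta).
Proof.
move=> pp pq npq iN.
(* The string from [gamma_0 = 0/1] starts with denominator 1; the facts on neighbours need
   [i > 0]. *)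
have [->|i0] := posnP i; first by exists 0; rewrite // /gamma_den /= coprime1n.
pose f j := gamma_den Q (i + j).
case: (boolP [exists j : 'I_6, coprime (f j) (p ^ alpha * q ^ beta)]).
  by case/existsP => j jP; exists j; rewrite // -ltnS.
move/existsPn => nP; exfalso.
have F j : j <= 5 -> (p %| f j) || (q %| f j).
  move=> j5; apply: coprime_pfactors pp pq (nP (Ordinal (_ : j < 6))).
  exact: j5.
have bd j : j <= 5 -> 0 < f j <= Q.
  by move=> j5; rewrite gamma_den_gt0 gamma_den_le //; lia.
have adj j : j <= 4 -> Q < f j + f j.+1 /\ coprime (f j) (f j.+1).
  move=> j4; rewrite /f addnS; split.
    by apply: gamma_den_add_gt; lia.
  by apply: coprime_gamma_den; lia.
have dv j : j <= 3 -> f j.+1 %| f j + f j.+2.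
  by move=> j3; rewrite /f !addnS; apply: gamma_den_dvd_add; lia.
(* The hypotheses are symmetric under swapping the primes together with their exponents. *)
wlog p0 : p q alpha beta pp pq npq nP F / p %| f 0.
  move=> W; have /orP[p0|q0] := F 0 isT; first exact: (W p q alpha beta).
  apply: (W q p beta alpha) => //; first by rewrite eq_sym.
  - by move=> j; rewrite mulnC.
  - by move=> j /F; rewrite orbC.
have F' j : j <= 5 -> (q %| f j) || (p %| f j) by move=> /F; rewrite orbC.
have q1 := dvd_alternate pp (adj 0 isT).2 p0 (F 1 isT).
have p2 := dvd_alternate pq (adj 1 isT).2 q1 (F' 2 isT).
have q3 := dvd_alternate pp (adj 2 isT).2 p2 (F 3 isT).
have p4 := dvd_alternate pq (adj 3 isT).2 q3 (F' 4 isT).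
have q5 := dvd_alternate pp (adj 4 isT).2 p4 (F 5 isT).
exact: no_alternating_divisors pp pq npq bd adj dv p0 p2 p4 q1 q3 q5.
Qed.

(** Well-ordering of the naturals; excluded middle decides whether a smaller bound exists. *)
Lemma ex_is_L (d L : nat) :
  coprime_in_strings d L -> exists2 M : nat, is_L d M & M <= L.
Proof.
elim/ltn_ind: L => L IH PL.
have [[L' [L'L PL']]|noless] :=
  classic (exists L', L' < L /\ coprime_in_strings d L').
  have [M isM ML'] := IH L' L'L PL'.
  by exists M; rewrite // ltnW // (leq_ltn_trans ML').
exists L => //; split=> // L' PL'; rewrite leqNgt; apply/negP => L'L.
by apply: noless; exists L'.
Qed.

Theorem lemma3 (p q alpha beta : nat) (p_prime : prime p) (q_prime : prime q)
    (p_neq_q : p != q) (alpha_ge1 : 1 <= alpha) (beta_ge1 : 1 <= beta) :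
  (forall Q i : nat, 0 < Q -> i + 5 <= size (farey Q) ->
     exists2 j : nat, j <= 5 &
       coprime (gamma_den Q (i + j)) (p ^ alpha * q ^ beta))
  /\ (exists2 L : nat, is_L (p ^ alpha * q ^ beta) L & L <= 5).
Proof.
split=> [Q i _|]; first exact: coprime_among_six_denominators.
by apply: ex_is_L => Q i _ _; apply: coprime_among_six_denominators.
Qed.
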